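(* Let $n\ge1$ and let $\varphi,u_1,\dots,u_n:\mathbb R_+^2\to\mathbb R_+$ each satisfy properties (I)–(IV) listed in the context. Consider the $n$-agent economy with CFMM trading function $\varphi$ and utilities $u_1,\dots,u_n$. Let $\mathbf R^{\mathsf{in}}\in(\mathbb R_{++}^2)^{n+1}$ be an interior initial market state and let $\mathbf R^*=(\mathbf r_0^*,\mathbf r_1^*,\dots,\mathbf r_n^* )\in\mathcal U(\mathbf R^{\mathsf{in}})$ be a unilateral equilibrium. Define weights $$w_i:=\frac{1}{\partial_yu_i(\mathbf r_i^* )}>0,\qquad i=1,\dots,n.$$ Then the utility $$u_A^w(\mathbf r):=\sup\Big\{\sum_{i=1}^nw_iu_i(\mathbf r_i):\ \sum_{i=1}^n\mathbf r_i=\mathbf r,\ \mathbf r_i\in\mathbb R_+^2\Big\},\qquad\mathbf r\in\mathbb R_+^2,$$ is a weak representative agent for $(\mathbf R^{\mathsf{in}},\mathbf R^* )$.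
   Context: Notation: $\mathbb R_+=[0,\infty)$, $\mathbb R_{++}=(0,\infty)$. For a function $u$ that is differentiable with nonzero partial derivatives at $(x,y)$, put $p(u,x,y):=\partial_xu(x,y)/\partial_yu(x,y)$. Properties of a function $u:\mathbb R_+^2\to\mathbb R_+$: (I) $u$ is continuous, $u(x,0)=u(0,y)=0$ for all $x,y\in\mathbb R_+$, and $u$ is strictly increasing (in each coordinate) on $\mathbb R_{++}^2$. (II) $\lim_{x'\to\infty}u(x',y)=\infty$ and $\lim_{y'\to\infty}u(x,y')=\infty$ for every $x,y>0$. (III) $u$ is continuously differentiable and strictly concave on $\mathbb R_{++}^2$. (IV) For any $x_1,x_2,y_1,y_2\in\mathbb R_{++}$ with $x_1\le x_2$ and $y_1\ge y_2$, at least one inequality strict, $p(u,x_1,y_1)>p(u,x_2,y_2)$ whenever the prices are defined. $n$-agent market: a market state is $\mathbf R=(\mathbf r_0,\mathbf r_1,\dots,\mathbf r_n)\in(\mathbb R_+^2)^{n+1}$ ($\mathbf r_0$ = CFMM inventory, $\mathbf r_i$ = holding of agent $i$). $\mathcal U(\mathbf R^{\mathsf{in}})$ is the set of market states $\mathbf R$ with $\sum_{i=0}^n\mathbf r_i=\sum_{i=0}^n\mathbf r_i^{\mathsf{in}}$, $\varphi(\mathbf r_0)=\varphi(\mathbf r_0^{\mathsf{in}})$, and $u_i(\mathbf r_i)\ge u_i(\mathbf r_i^{\mathsf{in}})$ for $i=1,\dots,n$. (Such states are interior when $\mathbf R^{\mathsf{in}}$ is.) A trade $\mathbf h\in\mathbb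 R^2$ is valid for $\mathbf R$ and agent $i$ if $\mathbf r_0+\mathbf h\in\mathbb R_+^2$, $\varphi(\mathbf r_0+\mathbf h)=\varphi(\mathbf r_0)$ and $\mathbf r_i-\mathbf h\in\mathbb R_+^2$. A market state is a unilateral equilibrium if for each agent $i\in\{1,\dots,n\}$ there is no valid trade $\mathbf h$ with $u_i(\mathbf r_i-\mathbf h)>u_i(\mathbf r_i)$. Weak representative agent: write $\mathbf r_A^{\mathsf{in}}=\sum_{i=1}^n\mathbf r_i^{\mathsf{in}}$ and $\mathbf h^*=\mathbf r_0^*-\mathbf r_0^{\mathsf{in}}$. A function $u_A:\mathbb R_+^2\to\mathbb R$ is a weak representative agent for $(\mathbf R^{\mathsf{in}},\mathbf R^* )$ if $\mathbf h^*$ maximizes $u_A(\mathbf r_A^{\mathsf{in}}-\mathbf h)$ over all $\mathbf h\in\mathbb R^2$ satisfying $\mathbf r_0^{\mathsf{in}}+\mathbf h\in\mathbb R_+^2$, $\varphi(\mathbf r_0^{\mathsf{in}}+\mathbf h)=\varphi(\mathbf r_0^{\mathsf{in}})$ and $\mathbf r_A^{\mathsf{in}}-\mathbf h\in\mathbb R_+^2$. *)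

(* Defs.v *)
From HB Require Import structures.
From mathcomp Require Import all_boot all_order all_algebra.
From mathcomp Require Import all_classical all_reals all_analysis.
Set Implicit Arguments.
Unset Strict Implicit.
Unset Printing Implicit Defensive.
Import Order.TTheory GRing.Theory Num.Theory.
Import numFieldNormedType.Exports.
Local Open Scope classical_set_scope.
Local Open Scope ring_scope.

(* Functions on the closed quadrant are represented by total functions on the
   plane; only their values on the closed quadrant are ever constrained. *)

Definition quadrant (R : realType) : set (R * R) :=
  [set r | 0 <= r.1 /\ 0 <= r.2].

Definition open_quadrant (R : realType) : set (R * R) :=
  [set r | 0 < r.1 /\ 0 < r.2].

Definition partial_x (R : realType) (u : R * R -> R) (r : R * R) : R :=
  'D_((1, 0) : R * R) u r.

Definition partial_y (R : realType) (u : R * R -> R) (r : R * R) : R :=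
  'D_((0, 1) : R * R) u r.

Definition price_defined (R : realType) (u : R * R -> R) (r : R * R) : Prop :=
  [/\ differentiable u r, partial_x u r != 0 & partial_y u r != 0].

Definition price (R : realType) (u : R * R -> R) (r : R * R) : R :=
  partial_x u r / partial_y u r.

Definition strictly_increasing (R : realType) (u : R * R -> R) : Prop :=
  (forall x x' y : R, 0 < x -> 0 < y -> x < x' -> u (x, y) < u (x', y)) /\
  (forall x y y' : R, 0 < x -> 0 < y -> y < y' -> u (x, y) < u (x, y')).

Definition property_I (R : realType) (u : R * R -> R) : Prop :=
  [/\ {within @quadrant R, continuous u},
      forall x : R, 0 <= x -> u (x, 0) = 0,
      forall y : R, 0 <= y -> u (0, y) = 0
    & strictly_increasing u].

Definition property_II (R : realType) (u : R * R -> R) : Prop :=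
  (forall y : R, 0 < y -> u (x', y) @[x' --> +oo] --> +oo) /\
  (forall x : R, 0 < x -> u (x, y') @[y' --> +oo] --> +oo).

Definition continuously_differentiable (R : realType) (u : R * R -> R) : Prop :=
  forall r, @open_quadrant R r ->
    [/\ differentiable u r, {for r, continuous (partial_x u)}
      & {for r, continuous (partial_y u)}].

Definition strictly_concave (R : realType) (u : R * R -> R) : Prop :=
  forall (r s : R * R) (t : R), @open_quadrant R r -> @open_quadrant R s ->
    r != s -> 0 < t < 1 ->
    t * u r + (1 - t) * u s < u (t *: r + (1 - t) *: s).

Definition property_III (R : realType) (u : R * R -> R) : Prop :=
  continuously_differentiable u /\ strictly_concave u.

Definition property_IV (R : realType) (u : R * R -> R) : Prop :=
  forall x1 x2 y1 y2 : R, 0 < x1 -> 0 < x2 -> 0 < y1 -> 0 < y2 ->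
    x1 <= x2 -> y2 <= y1 -> (x1 < x2) || (y2 < y1) ->
    price_defined u (x1, y1) -> price_defined u (x2, y2) ->
    price u (x2, y2) < price u (x1, y1).

Definition regular_utility (R : realType) (u : R * R -> R) : Prop :=
  [/\ forall r, @quadrant R r -> 0 <= u r,
      property_I u, property_II u, property_III u & property_IV u].

(* Index [ord0] is the CFMM inventory; agents are indexed by ['I_n] and agent
   [i] sits at position [lift ord0 i], i.e. [i.+1]. *)
Definition allocation (R : realType) (n : nat) := 'I_n.+1 -> R * R.

Definition inventory (R : realType) (n : nat) (S : allocation R n) : R * R :=
  S ord0.

Definition holding (R : realType) (n : nat) (S : allocation R n) (i : 'I_n) :
  R * R := S (lift ord0 i).

Definition market_state (R : realType) (n : nat) (S : allocation R n) : Prop :=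
  forall k, @quadrant R (S k).

Definition interior_state (R : realType) (n : nat) (S : allocation R n) : Prop :=
  forall k, @open_quadrant R (S k).

(* The set of states written U(R^in). *)
Definition reachable (R : realType) (n : nat) (phi : R * R -> R)
    (u : 'I_n -> R * R -> R) (Sin : allocation R n) : set (allocation R n) :=
  [set S | [/\ market_state S, \sum_k S k = \sum_k Sin k,
               phi (inventory S) = phi (inventory Sin)
             & forall i, u i (holding Sin i) <= u i (holding S i)]].

(* [h] can be added to the inventory [r0] by a trader holding [r]. *)
Definition feasible_trade (R : realType) (phi : R * R -> R) (r0 r : R * R) :
    set (R * R) :=
  [set h | [/\ @quadrant R (r0 + h), phi (r0 + h) = phi r0
             & @quadrant R (r - h)]].

Definition valid_trade (R : realType) (n : nat) (phi : R * R -> R)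
    (S : allocation R n) (i : 'I_n) : set (R * R) :=
  feasible_trade phi (inventory S) (holding S i).

Definition unilateral_equilibrium (R : realType) (n : nat) (phi : R * R -> R)
    (u : 'I_n -> R * R -> R) (S : allocation R n) : Prop :=
  market_state S /\
  forall i, ~ exists2 h, valid_trade phi S i h &
                u i (holding S i) < u i (holding S i - h).

Definition weak_representative_agent (R : realType) (n : nat)
    (phi : R * R -> R) (Sin Sstar : allocation R n) (uA : R * R -> R) : Prop :=
  let rA := \sum_(i < n) holding Sin i in
  let hstar := inventory Sstar - inventory Sin in
  feasible_trade phi (inventory Sin) rA hstar /\
  forall h, feasible_trade phi (inventory Sin) rA h ->
    uA (rA - h) <= uA (rA - hstar).

Definition welfare_values (R : realType) (n : nat) (w : 'I_n -> R)
    (u : 'I_n -> R * R -> R) (r : R * R) : set R :=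
  [set v | exists s : 'I_n -> R * R,
     [/\ forall i, @quadrant R (s i), \sum_i s i = r
       & v = \sum_i w i * u i (s i)]].

Definition aggregate_utility (R : realType) (n : nat) (w : 'I_n -> R)
    (u : 'I_n -> R * R -> R) (r : R * R) : R :=
  sup (welfare_values w u r).

(* Main.v *)
Require Import Defs.
From HB Require Import structures.
From mathcomp Require Import all_boot all_order all_algebra.
From mathcomp Require Import all_classical all_reals all_analysis.
From mathcomp Require Import ring lra.
Set Implicit Arguments.
Unset Strict Implicit.
Unset Printing Implicit Defensive.
Import Order.TTheory GRing.Theory Num.Theory.
Import numFieldNormedType.Exports.
Local Open Scope classical_set_scope.
Local Open Scope ring_scope.

(* Unilateral optimality equalises every agent's price with the price p of the
   CFMM at its inventory: otherwise some trade along the level curve of phi is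
   profitable. The tangent bound for the concave u_i at r_i^*, weighted by
   w_i = 1 / d_y u_i(r_i^* ), then has slope (p, 1) for every agent, so the
   welfare of a split of r is at most the equilibrium welfare plus
   (p, 1) . (r - sum_i r_i^* ). The tangent bound for phi at r_0^* shows that a
   feasible aggregate trade can only make the last term nonpositive. *)

(** * Directional derivatives and one-sided limits in the plane *)

Section Calculus.
Context {R : realType}.
Implicit Types (f : R * R -> R) (r s v : R * R).

Lemma derive_gradient f r v : differentiable f r ->
  'D_v f r = partial_x f r * v.1 + partial_y f r * v.2.
Proof.
move=> df; rewrite /partial_x /partial_y !deriveE//.
have {1}-> : v = v.1 *: ((1, 0) : R * R) + v.2 *: ((0, 1) : R * R).
  by apply: injective_projections => /=; rewrite /GRing.scale /=; ring.
by rewrite linearD !linearZ /= /GRing.scale /= [v.1 * _]mulrC [v.2 * _]mulrC.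
Qed.

Lemma diff_quotient_cvg f r v : differentiable f r ->
  t^-1 * (f (r + t *: v) - f r) @[t --> 0^'+] --> 'D_v f r.
Proof.
move=> df; apply: cvg_dnbhs_at_right.
under eq_fun do rewrite [r + _]addrC.
exact: (@diff_derivable _ _ _ f r v df).
Qed.

Lemma near_increasing f r v : differentiable f r -> 0 < 'D_v f r ->
  \forall t \near 0^'+, f r < f (r + t *: v).
Proof.
move=> df D0; near=> t.
rewrite -subr_gt0 -(pmulr_rgt0 _ (_ : 0 < t^-1)) ?invr_gt0//.
by near: t; exact: cvgr_gt (diff_quotient_cvg df) _ D0.
Unshelve. all: by end_near.
Qed.

Lemma near_open_quadrant r v : @open_quadrant R r ->
  \forall t \near 0^'+, @open_quadrant R (r + t *: v).
Proof.
move=> [r1 r2].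
have H (a b : R) : 0 < a -> \forall t \near 0^'+, 0 < a + t * b.
  move=> a0; apply: (@cvgr_gt _ _ _ _ _ a) => //.
  have ab : a + t * b @[t --> 0] --> a + 0 * b.
    by apply: cvgD; [exact: cvg_cst|apply: cvgM; [exact: cvg_id|exact: cvg_cst]].
  by rewrite mul0r addr0 in ab; exact: cvg_at_right_filter.
by near=> t; split; near: t; exact: H.
Unshelve. all: by end_near.
Qed.

End Calculus.

(** * Positivity, tangent bounds and monotonicity of a single regular utility *)

Section Utility.
Context {R : realType} (u : R * R -> R) (hu : regular_utility u).
Implicit Types r s v : R * R.

Lemma utility_differentiable r : @open_quadrant R r -> differentiable u r.
Proof. by move=> r0; case: hu => _ _ _ [/(_ _ r0)[]]. Qed.

Lemma utility_boundary r : @quadrant R r -> ~ @open_quadrant R r -> u r = 0.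
Proof.
case: r => x y [/= x0 y0] nr; case: hu => _ [_ ux uy _] _ _ _.
have [xp|] := ltrP 0 x; last by move=> x_le; rewrite (_ : x = 0) ?uy//; lra.
have [yp|] := ltrP 0 y; first by case: nr.
by move=> y_le; rewrite (_ : y = 0) ?ux//; lra.
Qed.

Lemma utility_gt0 r : @open_quadrant R r -> 0 < u r.
Proof.
case: r => x y [/= x0 y0]; case: hu => u0 [_ _ _ [incx _]] _ _ _.
have xh : 0 < x / 2 by lra.
have : u (x / 2, y) < u (x, y) by apply: incx => //; lra.
by apply: le_lt_trans; apply: u0; split=> /=; exact: ltW.
Qed.

(** Serves to show that the equilibrium inventory and holdings are interior, since their values are
    at least those at an interior initial state. *)
Lemma utility_gt0_open r : @quadrant R r -> 0 < u r -> @open_quadrant R r.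
Proof.
move=> qr ur; apply: contrapT => /(utility_boundary qr) u0.
by rewrite u0 ltxx in ur.
Qed.

(** By concavity the difference quotients from [r] towards [s] are at least [u s - u r] for
    [0 < t < 1]; let [t] tend to [0]. *)
Lemma tangent_bound_open r s : @open_quadrant R r -> @open_quadrant R s ->
  u s <= u r + 'D_(s - r) u r.
Proof.
move=> r0 s0; have [->|rs] := eqVneq s r.
  by rewrite subrr derive_gradient; [rewrite /= !mulr0 !addr0|exact: utility_differentiable].
rewrite -lerBlDl.
apply: cvgr_to_ge (diff_quotient_cvg (v:=s - r) (utility_differentiable r0)) _.
near=> t.
have t0 : 0 < t by [].
have t1 : t < 1 by near: t; exact: nbhs_right_lt.
have [_ _ _ [_ conc] _] := hu.
have := conc s r t s0 r0 rs; rewrite t0 t1 => /(_ isT).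
have -> : t *: s + (1 - t) *: r = r + t *: (s - r).
  by rewrite scalerBl scalerBr scale1r addrCA.
rewrite ler_pdivlMl//; lra.
Unshelve. all: by end_near.
Qed.

(* Boundary points are pushed inside along the diagonal; the value there is [0],
   so the push cannot lower the utility, and the bound passes to the limit. *)
Lemma tangent_bound r s : @open_quadrant R r -> @quadrant R s ->
  u s <= u r + partial_x u r * (s.1 - r.1) + partial_y u r * (s.2 - r.2).
Proof.
move=> r0 s0; have du := utility_differentiable r0.
have H s' : @open_quadrant R s' ->
    u s' <= u r + partial_x u r * (s'.1 - r.1) + partial_y u r * (s'.2 - r.2).
  by move=> s'0; rewrite -addrA -(derive_gradient (s' - r))//; exact: tangent_bound_open.
have [/H//|ns] := pselect (@open_quadrant R s).
rewrite (utility_boundary s0 ns).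
set a := partial_x u r; set b := partial_y u r; set c := (X in _ <= X).
rewrite leNgt; apply/negP => c0.
(* Chosen so that [c + |a + b| e = - e < 0]: the tangent bound would make [u] negative at the pushed
   point, where it is positive. *)
pose e := - c / (1 + `|a + b|).
have d0 : 0 < 1 + `|a + b| by rewrite ltr_wpDr.
have e0 : 0 < e by rewrite divr_gt0// oppr_gt0.
have q0 : @open_quadrant R (s.1 + e, s.2 + e).
  by case: s0 => s1 s2; split=> /=; rewrite ltr_wpDl.
have := H _ q0; have := utility_gt0 q0.
have -> : u r + partial_x u r * ((s.1 + e, s.2 + e).1 - r.1) +
   partial_y u r * ((s.1 + e, s.2 + e).2 - r.2) = c + (a + b) * e.
  by rewrite /c /a /b /=; ring.
have : (a + b) * e <= `|a + b| * e by rewrite ler_pM2r// ler_norm.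
have : e * (1 + `|a + b|) = - c by rewrite /e divfK// gt_eqF.
lra.
Qed.

(** A unit step along an axis strictly raises [u], and the tangent bound caps the gain by the
    partial derivative. *)
Lemma partials_gt0 r : @open_quadrant R r ->
  0 < partial_x u r /\ 0 < partial_y u r.
Proof.
case: r => x y [/= x0 y0]; case: (hu) => _ [_ _ _ [incx incy]] _ _ _.
have r0 : @open_quadrant R (x, y) by [].
have qx : @quadrant R (x + 1, y) by split=> /=; lra.
have qy : @quadrant R (x, y + 1) by split=> /=; lra.
have := tangent_bound r0 qx; have := tangent_bound r0 qy => /=.
have := incx x (x + 1) y; have := incy x y (y + 1).
rewrite !ltrDl ltr01 => /(_ x0 y0 isT) ? /(_ x0 y0 isT) ?.
rewrite !subrr !mulr0 !addr0 ![_ + 1 - _]addrAC !subrr !add0r !mulr1; lra.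
Qed.

Lemma utility_le r s : @open_quadrant R r -> r.1 <= s.1 -> r.2 <= s.2 ->
  u r <= u s.
Proof.
case: r s => x y [x' y'] [/= x0 y0] xx yy.
case: (hu) => _ [_ _ _ [incx incy]] _ _ _.
apply: (@le_trans _ _ (u (x', y))).
  by move: xx; rewrite le_eqVlt => /predU1P[->//|/incx H]; exact/ltW/H.
move: yy; rewrite le_eqVlt => /predU1P[->//|/incy H]; apply/ltW/H => //.
exact: lt_le_trans xx.
Qed.

End Utility.

(* Moving along [v] does not raise [phi]; adding a small diagonal displacement
   does, so the intermediate value theorem yields a trade on the level curve
   whose direction is close enough to [v] to stay profitable. *)
Lemma profitable_trade {R : realType} (phi u : R * R -> R) (r0 r v : R * R) :
  regular_utility phi -> regular_utility u ->
  @open_quadrant R r0 -> @open_quadrant R r ->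
  'D_v phi r0 = 0 -> 'D_v u r < 0 ->
  exists2 h, feasible_trade phi r0 r h & u r < u (r - h).
Proof.
move=> hphi hu o0 o Dphi Du.
have dphi := utility_differentiable hphi o0.
have du := utility_differentiable hu o.
have [a0 b0] := partials_gt0 hphi o0; have [c0 d0] := partials_gt0 hu o.
(* With this [e], the derivative of [u] along [v + (e, e)] is half of ['D_v u r], hence still
   negative. *)
pose e : R := - 'D_v u r / (2 * (partial_x u r + partial_y u r)).
have e0 : 0 < e by apply: divr_gt0; [rewrite oppr_gt0|rewrite mulr_gt0 ?addr_gt0].
have De : e * (2 * (partial_x u r + partial_y u r)) = - 'D_v u r.
  by rewrite divfK// gt_eqF// mulr_gt0 ?addr_gt0.
clearbody e; pose v' : R * R := v + (e, e).
have Dv' f s : differentiable f s ->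
    'D_v' f s = partial_x f s * (v.1 + e) + partial_y f s * (v.2 + e).
  by move=> df; exact: derive_gradient.
have DNv' f s : differentiable f s ->
    'D_(- v') f s = partial_x f s * - (v.1 + e) + partial_y f s * - (v.2 + e).
  by move=> df; exact: derive_gradient.
have Dphi' : 0 < 'D_v' phi r0.
  have := mulr_gt0 e0 (addr_gt0 a0 b0).
  by move: Dphi; rewrite Dv'// derive_gradient//; lra.
have Du' : 0 < 'D_(- v') u r.
  by move: De Du; rewrite DNv'// !derive_gradient//; lra.
have /filter_ex[t [t0 ot ot' phit ut]] : \forall t \near 0^'+, [/\ 0 < t,
    @open_quadrant R (r0 + t *: v), @open_quadrant R (r + t *: - v'),
    phi r0 < phi (r0 + t *: v') & u r < u (r + t *: - v')].
  near=> t; split=> //; near: t.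
  - exact: near_open_quadrant.
  - exact: near_open_quadrant.
  - exact: near_increasing.
  - exact: near_increasing.
pose path (x : R) := r0 + t *: (v + (x, x)).
have open_path x : 0 <= x -> @open_quadrant R (path x).
  move=> x0; have tx : 0 <= t * x by rewrite mulr_ge0// ltW.
  by case: ot; rewrite /open_quadrant /= /GRing.scale /= !mulrDr; lra.
have path0 : path 0 = r0 + t *: v.
  by rewrite /path (_ : (0, 0) = 0 :> R * R)// addr0.
have [x xe phix] : exists2 x, x \in `[0, e] & phi (path x) = phi r0.
  apply: (@IVT _ (phi \o path)) => [||/=]; first exact: ltW.
  - apply: continuous_in_subspaceT => x; rewrite inE /= in_itv /= => /andP[x0 _].
    apply: continuous_comp; last first.
      exact/differentiable_continuous/utility_differentiable/open_path.
    have comp (a b : R) : {for x, continuous (fun x => a + t * (b + x))}.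
      by apply: cvgD; [|apply: cvgM; [|apply: cvgD]]; first [exact: cvg_cst|exact: cvg_id].
    exact: cvg_pair (comp r0.1 v.1) (comp r0.2 v.2).
  (* At the start of the path the tangent bound applies with zero slope along [v]; at its end [phit]
     gives the opposite inequality. *)
  - have : phi (path 0) <= phi r0.
      have := tangent_bound_open hphi o0 (open_path _ (lexx 0)).
      rewrite path0 addrAC subrr add0r derive_gradient//=.
      move: Dphi; rewrite derive_gradient// => Dphi.
      have : t * (partial_x phi r0 * v.1 + partial_y phi r0 * v.2) = 0.
        by rewrite Dphi mulr0.
      rewrite /GRing.scale /=; lra.
    by move=> p0; rewrite ge_min p0 le_max (ltW phit) orbT.
move: xe; rewrite in_itv /= => /andP[x0 xe].
have txe : t * x <= t * e by rewrite ler_pM2l.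
(* Since [x <= e], the trader gives up no more of either good than in the trade [t *: v'], which is
   already profitable. *)
have le1 : (r + t *: - v').1 <= (r - t *: (v + (x, x))).1.
  by rewrite /= /GRing.scale /=; lra.
have le2 : (r + t *: - v').2 <= (r - t *: (v + (x, x))).2.
  by rewrite /= /GRing.scale /=; lra.
exists (t *: (v + (x, x))).
  split=> //; first by case: (open_path _ x0) => *; split; exact: ltW.
  by case: ot' => o1 o2; split; apply: ltW; [exact: lt_le_trans le1|exact: lt_le_trans le2].
exact: lt_le_trans ut (utility_le hu ot' le1 le2).
Unshelve. all: by end_near.
Qed.

Lemma equilibrium_price {R : realType} (phi u : R * R -> R) (r0 r : R * R) :
  regular_utility phi -> regular_utility u ->
  @open_quadrant R r0 -> @open_quadrant R r ->
  ~ (exists2 h, feasible_trade phi r0 r h & u r < u (r - h)) ->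
  price u r = price phi r0.
Proof.
move=> hphi hu o0 o noh.
have dphi := utility_differentiable hphi o0.
have du := utility_differentiable hu o.
have [a0 b0] := partials_gt0 hphi o0; have [c0 d0] := partials_gt0 hu o.
(* Tangent to the level curve of [phi]. The derivative of [u] along [v] has the sign of the price
   difference, so unequal prices make [v] or [- v] profitable. *)
pose v : R * R := (partial_y phi r0, - partial_x phi r0).
have Dphi : 'D_v phi r0 = 0 by rewrite derive_gradient//=; ring.
have DphiN : 'D_(- v) phi r0 = 0 by rewrite derive_gradient//=; ring.
apply/eqP; rewrite eqr_div ?lt0r_neq0// -subr_eq0.
have Du : 'D_v u r = partial_x u r * partial_y phi r0 - partial_x phi r0 * partial_y u r.
  by rewrite derive_gradient//=; ring.
have DuN : 'D_(- v) u r = - 'D_v u r by rewrite !derive_gradient//=; ring.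
rewrite -Du eq_le !leNgt; apply/andP; split; apply/negP => H; apply: noh.
  by apply: (profitable_trade (v := - v)) => //; rewrite DuN oppr_lt0.
exact: (profitable_trade (v := v)).
Qed.

Theorem proposition7 (R : realType) (n : nat) (hn : (1 <= n)%N)
    (phi : R * R -> R) (u : 'I_n -> R * R -> R)
    (hphi : regular_utility phi) (hu : forall i, regular_utility (u i))
    (Sin Sstar : allocation R n)
    (hin : interior_state Sin)
    (hreach : reachable phi u Sin Sstar)
    (heq : unilateral_equilibrium phi u Sstar) :
  let w := fun i : 'I_n => 1 / partial_y (u i) (holding Sstar i) in
  [/\ forall i, 0 < w i,
      forall r, quadrant r -> has_sup (welfare_values w u r)
    & weak_representative_agent phi Sin Sstar (aggregate_utility w u)].
Proof.
case: hreach => mS sumS phiS uS; case: heq => _ eqS.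
pose rs := holding Sstar; pose r0 := inventory Sstar.
have o0 : @open_quadrant R r0.
  apply: (utility_gt0_open hphi); first exact: mS.
  by rewrite phiS; apply: utility_gt0 => //; exact: hin.
have o i : @open_quadrant R (rs i).
  apply: (utility_gt0_open (hu i)); first exact: mS.
  by apply: lt_le_trans (uS i); apply: utility_gt0 => //; exact: hin.
move=> w.
have uy0 i : 0 < partial_y (u i) (rs i) by case: (partials_gt0 (hu i) (o i)).
have w0 i : 0 < w i by rewrite divr_gt0.
have fst_sum (s : 'I_n -> R * R) : (\sum_i s i).1 = \sum_i (s i).1 by exact: raddf_sum.
have snd_sum (s : 'I_n -> R * R) : (\sum_i s i).2 = \sum_i (s i).2 by exact: raddf_sum.
pose p := price phi r0.
pose W := \sum_i w i * u i (rs i).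
have wtangent i s : @quadrant R s ->
    w i * u i s <= w i * u i (rs i) + (p * (s.1 - (rs i).1) + (s.2 - (rs i).2)).
  move=> qs; have := tangent_bound (hu i) (o i) qs.
  rewrite -(ler_pM2l (w0 i)) => /le_trans; apply.
  have <- : price (u i) (rs i) = p.
    by apply: equilibrium_price => //; exact: eqS.
  (* The weight scales the gradient of [u i] at [rs i] to [(p, 1)], so the two sides are equal. *)
  rewrite le_eqVlt; apply/orP; left; apply/eqP.
  by rewrite /w /price; field; rewrite gt_eqF.
have bound r v : welfare_values w u r v ->
    v <= W + (p * (r - \sum_i rs i).1 + (r - \sum_i rs i).2).
  move=> [s [qs <- ->]].
  apply: (le_trans (ler_sum _ (fun i _ => wtangent i (s i) (qs i)))).
  rewrite big_split /= lerD2l big_split /= -mulr_sumr.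
  by rewrite !sumrB !fst_sum !snd_sum.
have supW r : quadrant r -> has_sup (welfare_values w u r).
  move=> qr; split; last by eexists => v; exact: bound.
  (* Nonemptiness: the first agent, who exists because [1 <= n], receives everything. *)
  pose s i := if i == Ordinal hn then r else 0.
  exists (\sum_i w i * u i (s i)), s; split=> //.
    by move=> i; rewrite /s; case: ifP => // _; split.
  by rewrite -big_mkcond big_pred1_eq.
have sumA : \sum_(i < n) holding Sin i - (r0 - inventory Sin) = \sum_i rs i.
  move: sumS; rewrite !big_ord_recl -/(inventory Sstar) -/(inventory Sin) -/r0 => E.
  by apply: (addrI r0); rewrite [RHS]E opprB addrCA subrKC addrC.
have qrs : quadrant (\sum_i rs i).
  by split; rewrite ?fst_sum ?snd_sum; apply: sumr_ge0 => i _; case: (o i) => *; exact: ltW.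
split=> //; split.
  split.
  - by rewrite addrC subrK; exact: mS.
  - by rewrite addrC subrK.
  - by rewrite sumA.
move=> h [q0 phih qh]; rewrite sumA.
(* [W] separates the two sides: it bounds every split of [rA - h], and the split [rs] of the
   equilibrium aggregate attains it. *)
apply: (@le_trans _ _ W).
  apply: ge_sup; first by case: (supW _ qh).
  move=> v /bound /le_trans; apply; rewrite gerDl -sumA.
  have := tangent_bound hphi o0 q0; rewrite phih -phiS.
  have [_ b0] := partials_gt0 hphi o0.
  set z := inventory Sin; set A := \sum_(i < n) _.
  have -> : A - h - (A - (r0 - z)) = r0 - (z + h).
    by apply: injective_projections => /=; ring.
  (* Scaling by [partial_y phi r0 > 0] turns [(p, 1)] into the gradient of [phi]; as [z + h] lies on
     the level curve of [r0], the tangent bound gives the sign. *)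
  move=> ineq; rewrite -(pmulr_rle0 _ b0) /p /price mulrDr mulrA mulrCA mulfV ?gt_eqF// mulr1.
  by move: ineq; rewrite /=; lra.
apply: ub_le_sup; first by case: (supW _ qrs).
by exists rs; split=> // i; case: (o i) => *; split; exact: ltW.
Qed.
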